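(* To simulate the first $N$ customers in a tandem queue with $M$ servers, Algorithm 3 (described in the context) using $P$ processors requires the time $$T_P = O\left(2M+2N+2\left\lfloor\frac{L_1-1}{P}\right\rfloor (L_2-P)\right)\qquad\text{as } M,N\to\infty,$$ where $L_1=\min(M+1,N)$ and $L_2=\max(M+1,N)$.
   Context: Tandem queue. Consider $M\ge 1$ single-server queues in series with infinite buffers, starting at time zero and free of customers at that time. Let $\tau_{0,j}\ge 0$ be the time between the arrivals of the $j$th customer and his predecessor, and $\tau_{i,j}\ge 0$ the service time of customer $j$ at server $i$ ($1\le i\le M$, $j\ge1$); these are given. Let $D_{0,j}$ be the $j$th arrival epoch to the system and $D_{i,j}$ the $j$th departure epoch from server $i$; let $B_{i,j}$ be the $j$th initiation of service at server $i$. With $D_{i,0}=0$ for $0\le i\le M$ and $D_{-1,j}=0$ for $j\ge1$, the dynamics are $$B_{i,j}=\max(D_{i-1,j},D_{i,j-1}),\qquad D_{i,j}=B_{i,j}+\tau_{i,j},\qquad 0\le i\le M,\ j\ge 1.$$ Algorithm 3 (parallel simulation of the first $N$ customers). For each $k=1,\dots,M+N$ in turn: first, in parallel for all integers $j$ with $\max(1,k-M)\le j\le \min(k,N)$, compute $B_{k-j,j}=\max(D_{k-j-1,j},D_{k-j,j-1})$; then, in parallel for all the same $j$, compute $D_{k-j,j}=B_{k-j,j}+\tau_{k-j,j}$. Time model. Each maximization and each addition takes one unit of time on one processor; time for index computation, data allocation and movement, and processor synchronization is ignored. If $P$ processors are available, a batch of $l$ operations to be done in parallel is split sequentially into groups of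 $P$ operations, so that it takes time $\lfloor (l-1)/P\rfloor+1$. Thus, if $l_k$ is the number of integers $j$ with $\max(1,k-M)\le j\le\min(k,N)$, the time of Algorithm 3 with $P$ processors is $$T_P=2\sum_{k=1}^{M+N}\left(\left\lfloor\frac{l_k-1}{P}\right\rfloor+1\right).$$ *)

(* Defs.v *)
From mathcomp Require Import all_boot all_order all_algebra.
From mathcomp Require Import all_classical all_reals all_analysis.
From mathcomp Require Import zify.
Set Implicit Arguments.
Unset Strict Implicit.
Unset Printing Implicit Defensive.
Import Order.TTheory GRing.Theory Num.Theory.
Import numFieldNormedType.Exports.
Local Open Scope ring_scope.

(* Server 0 is the arrival process: [D 0 j] is the j-th arrival epoch.  The
   convention D_{-1,j} = 0 is carried by [upstream], since i ranges over nat. *)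
Definition upstream (R : realType) (D : nat -> nat -> R) (i j : nat) : R :=
  if i is i'.+1 then D i' j else 0.

Definition tandem_dynamics (R : realType) (M : nat) (tau B D : nat -> nat -> R) :=
  (forall i, (i <= M)%N -> D i 0%N = 0) /\
  (forall i j, (i <= M)%N -> (1 <= j)%N ->
     B i j = Num.max (upstream D i j) (D i j.-1) /\ D i j = B i j + tau i j).

(* Memory of the simulation, with the time elapsed so far. *)
Record sim_state (R : realType) := SimState {
  beg : nat -> nat -> R;
  dep : nat -> nat -> R;
  clock : nat }.

(* For l >= 1, the time taken on P processors by l unit-time operations.  The
   batches of the algorithm are never empty, so truncation at l = 0 is
   irrelevant. *)
Definition batch_time (P l : nat) : nat := (l.-1 %/ P + 1)%N.

(* The integers j with max(1, k - M) <= j <= min(k, N). *)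
Definition customers (M N k : nat) : seq nat :=
  index_iota (maxn 1 (k - M)) (minn k N).+1.

(* One batch of maximizations, writing the cells (k - j, j) for j in [js]. *)
Definition max_batch (R : realType) (P k : nat) (js : seq nat)
    (s : sim_state R) : sim_state R :=
  SimState
    (fun i j => if (j \in js) && (i + j == k)%N
                then Num.max (upstream (dep s) i j) (dep s i j.-1)
                else beg s i j)
    (dep s)
    (clock s + batch_time P (size js)).

Definition add_batch (R : realType) (P k : nat) (js : seq nat)
    (tau : nat -> nat -> R) (s : sim_state R) : sim_state R :=
  SimState
    (beg s)
    (fun i j => if (j \in js) && (i + j == k)%N
                then beg s i j + tau i j
                else dep s i j)
    (clock s + batch_time P (size js)).

Definition sim_init (R : realType) : sim_state R :=
  SimState (fun _ _ => 0) (fun _ _ => 0) 0.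

Definition sim_step (R : realType) (P M N : nat) (tau : nat -> nat -> R)
    (s : sim_state R) (k : nat) : sim_state R :=
  add_batch P k (customers M N k) tau (max_batch P k (customers M N k) s).

(* Parallel simulation of the first N customers of a tandem queue with M
   servers, on P processors: k = 1, ..., M + N in turn. *)
Definition simulate (R : realType) (P M N : nat) (tau : nat -> nat -> R) :
    sim_state R :=
  foldl (sim_step P M N tau) (sim_init R) (iota 1 (M + N)).

Definition sim_time (R : realType) (P M N : nat) (tau : nat -> nat -> R) : nat :=
  clock (simulate P M N tau).

Lemma sim_timeE (R : realType) (P M N : nat) (tau : nat -> nat -> R) :
  sim_time P M N tau =
    (2 * \sum_(1 <= k < (M + N).+1)
           (((size (customers M N k)).-1 %/ P) + 1))%N.
Proof.
rewrite /sim_time /simulate.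
have H (r : seq nat) (s : sim_state R) : clock (foldl (sim_step P M N tau) s r) =
   (clock s + 2 * \sum_(k <- r) (((size (customers M N k)).-1 %/ P) + 1))%N.
  elim: r s => [|k r IH] s /=; first by rewrite big_nil muln0 addn0.
  by rewrite IH big_cons /= /batch_time; lia.
by rewrite H /= add0n /index_iota subSS subn0.
Qed.

Lemma simulateP (R : realType) (P M N : nat) (tau B D : nat -> nat -> R) :
  tandem_dynamics M tau B D ->
  forall i j, (i <= M)%N -> (1 <= j <= N)%N ->
    beg (simulate P M N tau) i j = B i j /\ dep (simulate P M N tau) i j = D i j.
Proof.
move=> [D0 dyn].
pose inv n (s : sim_state R) :=
  (forall i, dep s i 0%N = 0) /\
  (forall i j, (i <= M)%N -> (1 <= j <= N)%N -> (i + j <= n)%N ->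
     beg s i j = B i j /\ dep s i j = D i j).
have H n : inv n (foldl (sim_step P M N tau) (sim_init R) (iota 1 n)).
  elim: n => [|n [s0 sn]]; first by split=> // i j _ /andP[j1 _]; lia.
  rewrite -addn1 iotaD foldl_cat /= -/(iota 1 n) add1n addn1.
  set s := foldl _ _ _ in s0 sn *.
  split=> [i|i j iM jN ijn] /=.
    have -> : (0%N \in customers M N n.+1) = false.
      by rewrite mem_index_iota; lia.
    exact: s0.
  case: (eqVneq (i + j)%N n.+1) => [e|ne]; last first.
    by rewrite andbF; apply: sn => //; lia.
  have -> : j \in customers M N n.+1 by rewrite mem_index_iota; lia.
  rewrite /=; have [-> ->] := dyn i j iM ltac:(lia).
  have -> : upstream (dep s) i j = upstream D i j.
    case: i iM ijn e => //= i iM ijn e.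
    by have [] := sn i j ltac:(lia) jN ltac:(lia).
  suff -> : dep s i j.-1 = D i j.-1.
    by split=> //; have [-> _] := dyn i j iM ltac:(lia).
  case: j jN ijn e => [//|[|j]] jN ijn e /=; first by rewrite s0 D0.
  by have [] := sn i j.+1 iM ltac:(lia) ltac:(lia).
by move=> i j iM jN; have [_ /(_ i j iM jN)] := H (M + N)%N; apply; lia.
Qed.

Definition time_bound (R : realType) (P M N : nat) : R :=
  let L1 := minn M.+1 N in
  let L2 := maxn M.+1 N in
  2 * M%:R + 2 * N%:R + 2 * ((L1 - 1) %/ P)%N%:R * (L2%:R - P%:R).

(* Main.v *)
(** A batch of [l_k] operations takes one time unit plus [(l_k - 1) %/ P] extra
    ones.  The extra is at most [q := (L1 - 1) %/ P], and, since
    [l_k <= min(k, M + N + 1 - k)], it vanishes unless [P < k <= M + N - P].  So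
    the extras add up to at most [q (M + N - 2P) <= 2 q (L2 - P)], and [T_P] is
    at most twice the claimed bound. *)
Require Import Defs.
From mathcomp Require Import all_boot all_order all_algebra.
From mathcomp Require Import all_classical all_reals all_analysis.
From mathcomp Require Import zify.
Import Order.TTheory GRing.Theory Num.Theory.
Import numFieldNormedType.Exports.
Local Open Scope classical_set_scope.
Local Open Scope ring_scope.

Lemma sum_nat_between (a b n : nat) :
  (\sum_(1 <= k < n.+1) (a < k <= b) <= minn n b - a)%N.
Proof.
elim: n => [|n IHn]; first by rewrite big_geq.
rewrite big_nat_recr //=.
case: (ltnP a n.+1) => an; case: (leqP n.+1 b) => nb /=; lia.
Qed.

Lemma batch_extra_le (P M N k : nat) : (0 < P)%N ->
  ((size (customers M N k)).-1 %/ P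
     <= (minn M.+1 N - 1) %/ P * (P < k <= M + N - P))%N.
Proof.
move=> P0; rewrite size_iota.
case: (boolP (P < k <= M + N - P)%N) => kP; last first.
  by rewrite muln0 leqn0 divn_small //; lia.
by rewrite muln1 leq_div2r //; lia.
Qed.

Lemma batch_extra_sum_le (P M N : nat) : (0 < P)%N ->
  (\sum_(1 <= k < (M + N).+1) (size (customers M N k)).-1 %/ P
     <= 2 * ((minn M.+1 N - 1) %/ P * (maxn M.+1 N - P)))%N.
Proof.
move=> P0.
apply: (@leq_trans (\sum_(1 <= k < (M + N).+1)
    (minn M.+1 N - 1) %/ P * (P < k <= M + N - P))%N).
  by apply: leq_sum => k _; exact: batch_extra_le.
rewrite -big_distrr /= mulnCA leq_mul2l; apply/orP; right.
(* Since [M + N + 1] is the sum of the [minn] and the [maxn], it is at most twice the latter. *)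
by apply: leq_trans (sum_nat_between _ _ _) _; lia.
Qed.

Lemma sim_time_le (R : realType) (P M N : nat) (tau : nat -> nat -> R) :
  (0 < P)%N -> (sim_time P M N tau)%:R <= 2 * time_bound R P M N.
Proof.
move=> P0; rewrite sim_timeE big_split /= sum_nat_const_nat.
have := batch_extra_sum_le P M N P0.
rewrite /time_bound; set S := (\sum_(_ <= _ < _) _)%N.
(* The factor [L2 - P] is truncated in [SL] but real, possibly negative, in [time_bound]. The two
   agree if [P <= L2]; otherwise [L1 - 1 < P] makes the quotient in front of it zero. *)
case: (leqP P (maxn M.+1 N)) => [PL|LP] SL.
  rewrite -(natrB _ PL) -!natrM -!natrD -natrM ler_nat.
  by move: SL; set q := (_ %/ _)%N; lia.
have q0 : ((minn M.+1 N - 1) %/ P = 0)%N by apply: divn_small; lia.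
move: SL; rewrite q0 => SL.
by rewrite mulr0 mul0r addr0 -!natrM -natrD -natrM ler_nat; lia.
Qed.

(** Letting [P] and [tau] vary with [M] and [N] makes the estimate uniform in both. *)
Theorem lemma1 (R : realType) (P : nat -> nat -> nat)
    (tau : nat -> nat -> nat -> nat -> R)
    (P_gt0 : forall M N, (0 < P M N)%N)
    (tau_ge0 : forall M N i j, (i <= M)%N -> (1 <= j)%N -> 0 <= tau M N i j) :
  (fun MN : nat * nat =>
     (sim_time (P MN.1 MN.2) MN.1 MN.2 (tau MN.1 MN.2))%:R : R^o)
  =O_ (filter_prod \oo \oo)
  (fun MN : nat * nat => time_bound R (P MN.1 MN.2) MN.1 MN.2 : R^o).
Proof.
(* The constant of [sim_time_le] works for all [M] and [N], not only for large ones. *)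
apply/eqO_exP; exists 2; first by [].
apply: filterE => -[M N] /=.
rewrite ger0_norm //.
apply: le_trans (sim_time_le _ _ _ _ _ (P_gt0 M N)) _.
by rewrite ler_pM2l // ler_norm.
Qed.
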